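(* Let $(P_\theta:\theta\in\Theta)$ be a collection of distributions with densities $p_\theta$ with respect to a common measure $\mu$, let $\Theta_0\subset\Theta$, and let $Y_1,Y_2,\dots$ be i.i.d. from $P_{\theta^*}$. For each $t\ge1$ let $\widehat\theta_{1,t-1}\in\Theta$ be any non-anticipating estimator, i.e. one based on $Y_1,\dots,Y_{t-1}$ only, let $\widehat\theta_{0,t}\in\operatorname{argmax}_{\theta\in\Theta_0}\prod_{i=1}^tp_\theta(Y_i)$, let $$M_t=\frac{\prod_{i=1}^tp_{\widehat\theta_{1,i-1}}(Y_i)}{\prod_{i=1}^tp_{\widehat\theta_{0,t}}(Y_i)},$$ and let $\bar p_t=\min_{s\le t}1/M_s$. Then for any random time $T$ (not necessarily a stopping time) and any $x\in[0,1]$, $$\sup_{\theta^*\in\Theta_0}P_{\theta^*}(\bar p_T\le x)\le x .$$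
   Context: A random time is any random variable with values in $\mathbb N=\{1,2,\dots\}$, possibly depending on the whole data sequence. The initial estimator $\widehat\theta_{1,0}$ is a fixed element of $\Theta$. $1/M_s=\infty$ if $M_s=0$. The null maximum likelihood estimators $\widehat\theta_{0,t}$ are assumed to exist, and all quantities are assumed measurable as needed. *)

(* Defs.v *)
From HB Require Import structures.
From mathcomp Require Import all_boot all_order all_algebra finmap.
From mathcomp Require Import all_classical all_reals all_analysis.

Set Implicit Arguments.
Unset Strict Implicit.
Unset Printing Implicit Defensive.

Import Order.TTheory GRing.Theory Num.Theory.
Import numFieldNormedType.Exports.

Local Open Scope classical_set_scope.
Local Open Scope ring_scope.

(* The observations Y_1, Y_2, ... are indexed from 0: [Y i] is Y_{i+1}, so the
   first t observations are the [Y i] with i < t. *)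

Definition is_density (R : realType) (d : measure_display)
    (S : measurableType d) (mu : {measure set S -> \bar R})
    (P : probability S R) (p : S -> R) : Prop :=
  [/\ measurable_fun [set: S] p,
      (forall y, 0 <= p y) &
      (forall A, measurable A -> P A = (\int[mu]_(y in A) (p y)%:E)%E)].

Definition mutually_independent (R : realType) (d dS : measure_display)
    (Omega : measurableType d) (S : measurableType dS)
    (Q : probability Omega R) (Y : nat -> {mfun Omega >-> S}) : Prop :=
  forall (J : {fset nat}) (A : nat -> set S),
    (forall i, i \in J -> measurable (A i)) ->
    Q (\bigcap_(i in [set` J]) Y i @^-1` A i)
    = (\prod_(i <- J) Q (Y i @^-1` A i))%E.

Definition iid_from (R : realType) (d dS : measure_display)
    (Omega : measurableType d) (S : measurableType dS)
    (Q : probability Omega R) (P : probability S R)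
    (Y : nat -> {mfun Omega >-> S}) : Prop :=
  mutually_independent Q Y /\
  forall i A, measurable A -> distribution Q (Y i) A = P A.

Definition past (Omega S : Type) (Y : nat -> Omega -> S) (t : nat) (w : Omega) :
  t.-tuple S := [tuple Y i w | i < t].

Definition likelihood (R : realType) (Theta Omega S : Type)
    (p : Theta -> S -> R) (Y : nat -> Omega -> S) (t : nat) (theta : Theta)
    (w : Omega) : R :=
  \prod_(i < t) p theta (Y i w).

(* [theta1 i], a function of the first i observations only, is the estimator
   with index (1, i); it is plugged in at the (i+1)-st observation. *)
Definition plugin_likelihood (R : realType) (Theta Omega S : Type)
    (p : Theta -> S -> R) (Y : nat -> Omega -> S)
    (theta1 : forall i : nat, i.-tuple S -> Theta) (t : nat) (w : Omega) : R :=
  \prod_(i < t) p (theta1 i (past Y i w)) (Y i w).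

Definition is_argmax (R : realType) (T : Type) (A : set T) (f : T -> R)
    (x : T) : Prop :=
  A x /\ forall z, A z -> f z <= f x.

(* The quotient is taken in the extended reals, where 0^-1 = +oo, a / 0 = +oo
   for a > 0 and 0 / 0 = 0. *)
Definition running_mle_ratio (R : realType) (Theta Omega S : Type)
    (p : Theta -> S -> R) (Y : nat -> Omega -> S)
    (theta1 : forall i : nat, i.-tuple S -> Theta)
    (theta0 : nat -> Omega -> Theta) (t : nat) (w : Omega) : \bar R :=
  ((plugin_likelihood p Y theta1 t w)%:E
   / (likelihood p Y t (theta0 t w) w)%:E)%E.

Definition running_pvalue (R : realType) (Theta Omega S : Type)
    (p : Theta -> S -> R) (Y : nat -> Omega -> S)
    (theta1 : forall i : nat, i.-tuple S -> Theta)
    (theta0 : nat -> Omega -> Theta) (t : nat) (w : Omega) : \bar R :=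
  \big[Order.min/+oo%E]_(1 <= s < t.+1)
    ((running_mle_ratio p Y theta1 theta0 s w)^-1)%E.

(* Main.v *)
(* Let [theta] be the true null parameter.  Since the plug-in estimator only
   uses the past, independence gives each factor
   [p (theta1 i past) (Y i) / p theta (Y i)] conditional mean at most [1], so
   their running product [L] is a nonnegative supermartingale started at [1].
   The maximum likelihood estimator satisfies [lik theta <= lik theta0], so,
   off the null event where some [p theta (Y i)] vanishes, the running p-value
   can be at most [x] at any time only if [L] ever reaches [1 / x].  By Ville's
   inequality this has probability at most [x]; the bound covers all times at
   once, which is why [T] is arbitrary.  The base measure [mu] need not be
   sigma-finite: Fubini is only applied to the laws of the observations. *)
Require Import Defs.
From HB Require Import structures.
From mathcomp Require Import all_boot all_order all_algebra finmap.
From mathcomp Require Import all_classical all_reals all_analysis.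
From mathcomp Require Import measurable_realfun.

Set Implicit Arguments.
Unset Strict Implicit.
Unset Printing Implicit Defensive.

Import Order.TTheory GRing.Theory Num.Theory.
Import numFieldNormedType.Exports.

Local Open Scope classical_set_scope.
Local Open Scope ring_scope.

(** * Densities and integrals against the laws they define *)

Lemma measurable_fun_inv (R : realType) (d : measure_display)
    (T : measurableType d) (f : T -> R) :
  (forall x, 0 <= f x) -> measurable_fun setT f ->
  measurable_fun setT (fun x => (f x)^-1).
Proof.
(* [powR] with exponent -1 agrees with inversion on nonnegative reals, including at 0, where both
   give 0. *)
move=> f0 mf; rewrite (_ : (fun x => _) = (@powR R ^~ (-1)) \o f).
  exact: measurableT_comp.
by apply/funext => x /=; rewrite powR_inv1.
Qed.

Import HBNNSimple.

(** By linearity it suffices to treat the indicators of the level sets of [h], where the identity is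
    the defining property of a density. *)
Lemma integral_density_nnsfun (R : realType) (d : measure_display)
    (S : measurableType d) (mu : {measure set S -> \bar R})
    (P : probability S R) (p : S -> R) (h : {nnsfun S >-> R}) :
  is_density mu P p ->
  (\int[P]_y (h y)%:E = \int[mu]_y (h y * p y)%:E)%E.
Proof.
move=> [mp p0 Pp].
transitivity (\int[P]_y
   (\sum_(r \in range h) (r * \1_(h @^-1` [set r]) y)%:E))%E.
  by apply: eq_integral => t _; rewrite [in LHS]fimfunE -fsumEFin.
rewrite ge0_integral_fsum//; last 2 first.
  - by move=> r; apply/measurable_EFinP; exact: measurable_funM.
  - by move=> r y _; exact: nnfun_muleindic_ge0.
transitivity (\int[mu]_y
   (\sum_(r \in range h) ((r * \1_(h @^-1` [set r]) y) * p y)%:E))%E; last first.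
  apply: eq_integral => t _.
  under [LHS]eq_fsbigr do rewrite EFinM.
  rewrite -ge0_mule_fsuml; last by move=> r; exact: nnfun_muleindic_ge0.
  by rewrite fsumEFin// [in RHS]fimfunE.
rewrite ge0_integral_fsum//; last 2 first.
  - move=> r; apply/measurable_EFinP; apply: measurable_funM => //.
    exact: measurable_funM.
  - by move=> r y _; rewrite EFinM; apply: mule_ge0;
    [exact: nnfun_muleindic_ge0|rewrite lee_fin].
apply: eq_fsbigr => r rh.
have r0 : 0 <= r by move: rh; rewrite inE => -[t _ <-].
under eq_integral do rewrite EFinM.
rewrite ge0_integralZl//; last exact/measurable_EFinP.
under [RHS]eq_integral do rewrite -mulrA EFinM.
rewrite ge0_integralZl//; last 2 first.
  - by apply/measurable_EFinP; exact: measurable_funM.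
  - by move=> y _; rewrite lee_fin mulr_ge0.
congr (_ * _)%E.
transitivity (P (h @^-1` [set r])); first by rewrite integral_indic// setIT.
rewrite Pp// integral_mkcond.
apply: eq_integral => y _.
by rewrite patchE indicE; case: ifP => _; rewrite ?mul1r ?mul0r.
Qed.

(** Simple functions increase to [f], and still do so after multiplication by the nonnegative [p],
    so monotone convergence applies on both sides. *)
Lemma integral_density (R : realType) (d : measure_display)
    (S : measurableType d) (mu : {measure set S -> \bar R})
    (P : probability S R) (p f : S -> R) :
  is_density mu P p -> measurable_fun setT f -> (forall y, 0 <= f y) ->
  (\int[P]_y (f y)%:E = \int[mu]_y (f y * p y)%:E)%E.
Proof.
move=> Pp mf f0; have [mp p0 _] := Pp.
have mEf : measurable_fun setT (EFin \o f) by exact/measurable_EFinP.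
pose h := nnsfun_approx measurableT mEf.
have cvgh y : (h n y)%:E @[n --> \oo] --> (f y)%:E.
  by apply: (@cvg_nnsfun_approx _ _ _ _ measurableT (EFin \o f)) => // ? _ /=;
    rewrite lee_fin.
have ndh y : {homo (fun n => h n y) : m n / (m <= n)%N >-> m <= n}.
  by move=> m n mn; exact/lefP/nd_nnsfun_approx.
transitivity (lim (\int[P]_y (h n y)%:E @[n --> \oo])%E).
  rewrite -monotone_convergence//.
  - by apply: eq_integral => y _; apply/esym/cvg_lim.
  - by move=> n; exact/measurable_EFinP.
  - by move=> n y _; rewrite lee_fin.
  - by move=> y _ m n mn; rewrite lee_fin ndh.
under eq_fun do rewrite (integral_density_nnsfun _ Pp).
rewrite -monotone_convergence//.
- apply: eq_integral => y _; apply/cvg_lim => //.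
  rewrite EFinM; under eq_fun do rewrite EFinM.
  by apply: cvgeZr.
- by move=> n; apply/measurable_EFinP; exact: measurable_funM.
- by move=> n y _; rewrite lee_fin mulr_ge0.
- by move=> y _ m n mn; rewrite lee_fin ler_wpM2r// ndh.
Qed.

(* [q / p] is [0] where [p] vanishes, so the integral may be less than [1]. *)
Lemma integral_likelihood_ratio_le1 (R : realType) (d : measure_display)
    (S : measurableType d) (mu : {measure set S -> \bar R})
    (P Q : probability S R) (p q : S -> R) :
  is_density mu P p -> is_density mu Q q ->
  (\int[P]_y (q y / p y)%:E <= 1)%E.
Proof.
move=> Pp Qq; have [mp p0 _] := Pp; have [mq q0 Qint] := Qq.
have mqp : measurable_fun setT (fun y => q y / p y).
  by apply: measurable_funM => //; exact: measurable_fun_inv.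
rewrite (integral_density Pp)//; last by move=> y; rewrite divr_ge0.
(* Writing 1 as the integral of [q] against [mu] leaves only a pointwise comparison of
   [q y / p y * p y] with [q y]. *)
rewrite -(@probability_setT _ _ _ Q) Qint//.
apply: ge0_le_integral => //.
- by move=> y _; rewrite lee_fin mulr_ge0// divr_ge0.
- by apply/measurable_EFinP; exact: measurable_funM.
- exact/measurable_EFinP.
- move=> y _; rewrite lee_fin.
  have [->|py0] := eqVneq (p y) 0; first by rewrite mulr0.
  by rewrite divfK.
Qed.

(** The density integrates to 0 over its own zero set. This later makes the outcomes with vanishing
    null likelihood negligible. *)
Lemma probability_density_eq0 (R : realType) (d : measure_display)
    (S : measurableType d) (mu : {measure set S -> \bar R})
    (P : probability S R) (p : S -> R) :
  is_density mu P p -> P (p @^-1` [set 0]) = 0%E.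
Proof.
move=> [mp p0 Pp]; rewrite Pp; last first.
  by rewrite -[X in measurable X]setTI; exact: mp.
by apply: integral0_eq => y /= ->.
Qed.

(** * Boxes as a generating pi-system of the tuple space *)

(** The sides are indexed by all of [nat], so that one kind of family serves boxes of every length
    and matches the families in [mutually_independent]. *)
Definition box (S : Type) (n : nat) (A : nat -> set S) : set (n.-tuple S) :=
  [set z | forall i : 'I_n, A i (tnth z i)].

Arguments box {S} n A.

Definition boxes (d : measure_display) (S : measurableType d) (n : nat) :
    set (set (n.-tuple S)) :=
  [set box n A | A in [set A : nat -> set S | forall i, measurable (A i)]].

Lemma measurable_box (d : measure_display) (S : measurableType d) (n : nat)
    (A : nat -> set S) :
  (forall i, measurable (A i)) -> measurable (box n A).
Proof.
move=> mA.
rewrite (_ : box n A = \bigcap_(i in [set: 'I_n]) ((@tnth n S)^~ i @^-1` A i)).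
  apply: fin_bigcap_measurable => // i _.
  by rewrite -[X in measurable X]setTI; exact: measurable_tnth.
by apply/seteqP; split => z /= zA i => [_|]; exact: zA.
Qed.

Lemma setI_closed_boxes (d : measure_display) (S : measurableType d) (n : nat) :
  setI_closed (@boxes d S n).
Proof.
move=> _ _ [A mA <-] [B mB <-]; exists (fun i => A i `&` B i).
  by move=> i; exact: measurableI.
apply/seteqP; split => z /=; first by move=> zAB; split => i; case: (zAB i).
by move=> [zA zB] i; split; [exact: zA|exact: zB].
Qed.

Lemma boxesT (d : measure_display) (S : measurableType d) (n : nat) :
  @boxes d S n setT.
Proof. by exists (fun=> setT) => //; apply/seteqP; split. Qed.

(** Coordinate cylinders generate the product sigma-algebra and are boxes with all other sides full;
    conversely every box is measurable. *)
Lemma measurable_tuple_boxes (d : measure_display) (S : measurableType d)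
    (n : nat) :
  @measurable _ (n.-tuple S) = <<s @boxes d S n >>.
Proof.
apply/seteqP; split.
- apply: smallest_sub; first exact: smallest_sigma_algebra.
  rewrite -bigcup_seq; apply: bigcup_sub => i _ _ [B mB <-].
  apply: sub_sigma_algebra; exists (fun j : nat => if j == i then B else setT).
    by move=> j; case: ifP.
  apply/seteqP; split => z /=.
  + by move=> /(_ i); rewrite eqxx.
  + by move=> [_ zB] j; case: eqP => // /val_inj ->.
- apply: smallest_sub; first exact: sigma_algebra_measurable.
  by move=> _ [A mA <-]; exact: measurable_box.
Qed.

(** * Independence of the past and the next observation *)

Lemma measurable_past (dO dS : measure_display) (Omega : measurableType dO)
    (S : measurableType dS) (Y : nat -> {mfun Omega >-> S}) (n : nat) :
  measurable_fun setT (past (fun i => Y i : Omega -> S) n).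
Proof.
apply/measurable_fun_tnthP => i.
rewrite (_ : _ \o _ = Y i)//.
by apply/funext => w /=; rewrite tnth_mktuple.
Qed.

Lemma past_box (Omega S : Type) (Y : nat -> Omega -> S) (n : nat)
    (A : nat -> set S) :
  past Y n @^-1` box n A = \bigcap_(i in [set i | (i < n)%N]) Y i @^-1` A i.
Proof.
apply/seteqP; split => w /=.
- by move=> wA i /= ltin; have := wA (Ordinal ltin); rewrite tnth_mktuple; exact.
- by move=> wA i; rewrite tnth_mktuple; apply: wA => /=.
Qed.

Section past_independence.
Context (R : realType) (dO dS : measure_display) (Omega : measurableType dO)
  (S : measurableType dS) (Q : probability Omega R)
  (Y : nat -> {mfun Omega >-> S}).
Hypothesis indY : mutually_independent Q Y.

Let X n : Omega -> n.-tuple S := past (fun i => Y i : Omega -> S) n.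

Let mX n : measurable_fun setT (X n). Proof. exact: measurable_past. Qed.

Let Xn n : {mfun Omega >-> n.-tuple S} :=
  HB.pack (X n) (isMeasurableFun.Build _ _ _ _ _ (@mX n)).

Lemma probability_past_box (n : nat) (A : nat -> set S) :
  (forall i, measurable (A i)) ->
  Q (X n @^-1` box n A) = (\prod_(i < n) Q (Y i @^-1` A i))%E.
Proof.
move=> mA; rewrite /X past_box.
pose J := [fset i in iota 0 n]%fset.
have -> : [set i | (i < n)%N] = [set` J].
  by apply/seteqP; split => i /=; rewrite !inE mem_iota add0n.
rewrite indY//.
rewrite (perm_big (iota 0 n)) ?big_mkord//=; last first.
  apply: uniq_perm; rewrite ?fset_uniq ?iota_uniq// => i.
  by rewrite !inE.
by rewrite -[in LHS](subn0 n) -/(index_iota 0 n) big_mkord.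
Qed.

(** The joint event says that the first [n.+1] observations lie in a box with last side [B];
    splitting off the last factor of its product gives the claim. *)
Lemma probability_past_box_next (n : nat) (A : nat -> set S) (B : set S) :
  (forall i, measurable (A i)) -> measurable B ->
  Q ((X n @^-1` box n A) `&` (Y n @^-1` B)) =
  (Q (X n @^-1` box n A) * Q (Y n @^-1` B))%E.
Proof.
move=> mA mB; pose A' i := if i == n then B else A i.
have mA' i : measurable (A' i) by rewrite /A'; case: ifP.
have A'E i : (i < n)%N -> A' i = A i.
  by move=> ltin; rewrite /A' ltn_eqF.
have -> : (X n @^-1` box n A) `&` (Y n @^-1` B) = X n.+1 @^-1` box n.+1 A'.
  rewrite /X !past_box; apply/seteqP; split => w /=.
  - move=> [wA wB] i /=; rewrite ltnS leq_eqVlt => /orP[/eqP->|ltin].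
      by rewrite /A' eqxx.
    by rewrite A'E//; exact: wA.
  - move=> wA'; split; last by have := wA' n (ltnSn n); rewrite /A' eqxx.
    by move=> i /= ltin; rewrite -A'E//; apply: wA'; exact: ltnW.
rewrite !probability_past_box// big_ord_recr/= /A' eqxx; congr (_ * _)%E.
by apply: eq_bigr => i _; rewrite ltn_eqF.
Qed.

(** For fixed [B] both sides are finite measures in [A]. They agree on boxes, which generate and are
    stable under intersection, hence everywhere. *)
Lemma probability_past_next (n : nat) (A : set (n.-tuple S)) (B : set S) :
  measurable A -> measurable B ->
  Q ((X n @^-1` A) `&` (Y n @^-1` B)) =
  (Q (X n @^-1` A) * Q (Y n @^-1` B))%E.
Proof.
move=> mA mB.
have mYB : measurable (Y n @^-1` B).
  by rewrite -[X in measurable X]setTI; exact: (measurable_funPT (Y n)).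
have c0 : 0 <= fine (Q (Y n @^-1` B)) by rewrite fine_ge0.
have [m1 m1E] : exists m : {measure set (n.-tuple S) -> \bar R},
    forall C, m C = Q ((X n @^-1` C) `&` (Y n @^-1` B)).
  (* Restricting [Q] to the event on the next observation and pushing it forward by the past gives
     the left-hand side as a measure. *)
  by unshelve eexists (pushforward (mrestr Q mYB) (X n)); first exact: mX.
pose m2 : {measure set (n.-tuple S) -> \bar R} :=
  mscale (NngNum c0) (distribution Q (Xn n)).
have m2E C : m2 C = (Q (X n @^-1` C) * Q (Y n @^-1` B))%E.
  transitivity ((fine (Q (Y n @^-1` B)))%:E * Q (X n @^-1` C))%E => //.
  by rewrite muleC fineK// fin_num_measure.
rewrite -m2E -m1E.
apply: (measure_unique (@boxes dS S n) (fun=> setT)) => //.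
- exact: measurable_tuple_boxes.
- exact: setI_closed_boxes.
- by move=> _; exact: boxesT.
- by rewrite bigcup_const.
- by move=> _ [C mC <-]; rewrite m1E m2E; exact: probability_past_box_next.
- by move=> _; rewrite m1E preimage_setT setTI (le_lt_trans (probability_le1 _ _))// ltry.
Qed.

(** The joint law of the past and the next observation is a product measure, so Tonelli applies.
    This plays the part of conditioning on the past. *)
Lemma integral_past_next (P : probability S R) (n : nat)
    (f : n.-tuple S * S -> \bar R) :
  (forall B, measurable B -> Q (Y n @^-1` B) = P B) ->
  measurable_fun setT f -> (forall z, 0 <= f z)%E ->
  (\int[Q]_w f (X n w, Y n w) =
   \int[Q]_w \int[P]_y f (X n w, y))%E.
Proof.
move=> YP mf f0.
have mXY : measurable_fun setT (fun w => (X n w, Y n w)).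
  by apply: measurable_fun_pair; [exact: mX|exact: measurable_funPT].
pose XY : {mfun Omega >-> (n.-tuple S * S)%type} :=
  HB.pack (fun w => (X n w, Y n w)) (isMeasurableFun.Build _ _ _ _ _ mXY).
transitivity (\int[distribution Q XY]_z f z)%E.
  by rewrite ge0_integral_distribution.
transitivity (\int[distribution Q (Xn n) \x P]_z f z)%E.
  apply: eq_measure_integral => A mA _; apply/esym.
  apply: product_measure_unique => // B C mB mC.
  transitivity (Q (X n @^-1` B) * Q (Y n @^-1` C))%E.
    exact: probability_past_next.
  by congr (_ * _)%E; exact: YP.
rewrite fubini_tonelli1// ge0_integral_distribution//.
- exact: measurable_fun_fubini_tonelli_F.
- by move=> z; apply: integral_ge0.
Qed.

End past_independence.

(** * Stopped products and Ville's inequality *)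

Definition tuple_belast (S : Type) (n : nat) (z : n.+1.-tuple S) : n.-tuple S :=
  [tuple tnth z (widen_ord (leqnSn n) i) | i < n].

Lemma tuple_belast_past (Omega S : Type) (Y : nat -> Omega -> S) (n : nat)
    (w : Omega) :
  tuple_belast (past Y n.+1 w) = past Y n w.
Proof. by apply: eq_from_tnth => i; rewrite !tnth_mktuple. Qed.

Lemma measurable_tuple_belast (d : measure_display) (S : measurableType d)
    (n : nat) :
  measurable_fun setT (@tuple_belast S n).
Proof.
apply/measurable_fun_tnthP => i.
rewrite (_ : _ \o _ = (@tnth n.+1 S)^~ (widen_ord (leqnSn n) i)).
  exact: measurable_tnth.
by apply/funext => z /=; rewrite tnth_mktuple.
Qed.

(* The running product of the [rho i], frozen from the first time at which it
   reaches [c]. *)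
Fixpoint stopped_product (R : realType) (S : Type)
    (rho : forall n, n.-tuple S * S -> R) (c : R) (n : nat) :
    n.-tuple S -> R :=
  match n with
  | 0 => fun=> 1
  | m.+1 => fun z =>
      let g := stopped_product rho c (tuple_belast z) in
      g * (if c <= g then 1 else rho m (tuple_belast z, tnth z ord_max))
  end.

Section ville.
Context (R : realType) (dO dS : measure_display) (Omega : measurableType dO)
  (S : measurableType dS) (Q : probability Omega R) (P : probability S R)
  (Y : nat -> {mfun Omega >-> S}).
Hypothesis iidY : iid_from Q P Y.
Variables (rho : forall n, n.-tuple S * S -> R) (c : R).
Hypothesis mrho : forall n, measurable_fun setT (@rho n).
Hypothesis rho_ge0 : forall n z, 0 <= @rho n z.
Hypothesis rho_le1 : forall n z, (\int[P]_y (@rho n (z, y))%:E <= 1)%E.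
Hypothesis c_gt0 : 0 < c.

Let X n : Omega -> n.-tuple S := past (fun i => Y i : Omega -> S) n.

Let mX n : measurable_fun setT (X n). Proof. exact: measurable_past. Qed.

Let L n w := \prod_(i < n) rho (X i w, Y i w).

Let N n := @stopped_product R S rho c n.

Let N_past n w : N (X n.+1 w) =
  N (X n w) * (if c <= N (X n w) then 1 else rho (X n w, Y n w)).
Proof. by rewrite /N /= tuple_belast_past tnth_mktuple. Qed.

Let N_ge0 n z : 0 <= @N n z.
Proof.
elim: n z => [|n IHn] z; first exact: ler01.
by rewrite /N /=; apply: mulr_ge0; [exact: IHn|case: ifP].
Qed.

Let mN n : measurable_fun setT (@N n).
Proof.
elim: n => [|n IHn]; first exact: measurable_cst.
have mNb : measurable_fun setT (fun z : n.+1.-tuple S => N (tuple_belast z)).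
  by apply: measurableT_comp => //; exact: measurable_tuple_belast.
have mbl : measurable_fun setT
    (fun z : n.+1.-tuple S => (tuple_belast z, tnth z ord_max)).
  apply: measurable_fun_pair; first exact: measurable_tuple_belast.
  exact: measurable_tnth.
apply: measurable_funM => //; apply: measurable_fun_ifT => //.
  exact: measurable_fun_ler.
by apply: (measurableT_comp (@mrho n) mbl).
Qed.

Let mNX n : measurable_fun setT (fun w => N (X n w)).
Proof. exact: (measurableT_comp (@mN n) (@mX n)). Qed.

Lemma integral_stopped_product_le1 n : (\int[Q]_w (N (X n w))%:E <= 1)%E.
Proof.
elim: n => [|n IHn].
  change (\int[Q]_w (cst 1 w) <= 1)%E.
  by rewrite integral_cst// mul1e probability_le1.
apply: le_trans IHn.
pose f (z : n.-tuple S * S) :=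
  (N z.1 * (if c <= N z.1 then 1 else rho z))%:E.
have mN1 : measurable_fun setT (fun z : n.-tuple S * S => N z.1).
  exact: (measurableT_comp (@mN n) measurable_fst).
have mf : measurable_fun setT f.
  apply/measurable_EFinP; apply: measurable_funM => //.
  by apply: measurable_fun_ifT => //; [exact: measurable_fun_ler|exact: mrho].
have f0 z : (0 <= f z)%E by rewrite lee_fin mulr_ge0//; case: ifP.
under eq_integral do rewrite N_past.
have [indY YP] := iidY.
rewrite (integral_past_next indY (P := P) (f := f))//; last exact: YP.
apply: ge0_le_integral => //.
- by move=> w _; exact: integral_ge0.
- apply: (@measurableT_comp _ _ _ _ _ _ (fubini_F P f) _ (X n)).
    exact: measurable_fun_fubini_tonelli_F.
  exact: mX.
- exact/measurable_EFinP.
- move=> w _; rewrite /f /= -[X in (_ <= X)%E](mule1 (N (X n w))%:E).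
  case: (boolP (c <= _)) => _.
    rewrite mulr1 integral_cst//.
    by rewrite lee_wpmul2l ?lee_fin// probability_le1.
  under eq_integral do rewrite EFinM.
  rewrite ge0_integralZl//; last 3 first.
  + apply/measurable_EFinP.
    exact: (measurableT_comp (@mrho n) (pair1_measurable _)).
  + by move=> y _; rewrite lee_fin.
  + by rewrite lee_fin.
  by rewrite lee_wpmul2l ?lee_fin.
Qed.

Let F n : set Omega := [set w | c <= N (X n w)].

Let mF n : measurable (F n).
Proof.
rewrite -[X in measurable X]setTI.
by apply: (measurable_fun_ler (f := cst c)).
Qed.

(** Markov's inequality for the stopped product. *)
Lemma probability_stopped_product_le n : (Q (F n) <= (c^-1)%:E)%E.
Proof.
rewrite -[X in (_ <= X)%E]mule1 lee_pdivlMl//.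
apply: le_trans (integral_stopped_product_le1 n).
rewrite -integral_cst//.
apply: (@le_trans _ _ (\int[Q]_(w in F n) (N (X n w))%:E)%E).
- apply: ge0_le_integral => //.
  + by move=> w _; rewrite lee_fin ltW.
  + by apply/measurable_EFinP; exact: measurable_funTS.
- apply: ge0_subset_integral => //; first exact/measurable_EFinP.
  by move=> w _; rewrite lee_fin.
Qed.

Lemma measurable_product_ge n : measurable [set w | c <= L n w].
Proof.
rewrite -[X in measurable X]setTI.
apply: (measurable_fun_ler (f := cst c)) => //.
apply: measurable_prod => i _.
have mXY : measurable_fun setT (fun w => (X i w, Y i w)).
  by apply: measurable_fun_pair; [exact: mX|exact: measurable_funPT].
by apply: (measurableT_comp (@mrho i) mXY).
Qed.

(** Freezing turns a bound at each fixed time into one over all times: once the stopped product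
    reaches [c] it stays there, so the events [F n] increase and continuity from below applies. *)
Lemma ville : (Q (\bigcup_n [set w | (c <= L n w)%R]) <= (c^-1)%:E)%E.
Proof.
have ndF : nondecreasing_seq F.
  apply/nondecreasing_seqP => n; apply/subsetPset => w /= cN.
  by rewrite /F /= N_past cN mulr1.
have mUF : measurable (\bigcup_n F n) by exact: bigcup_measurable.
have LF : \bigcup_n [set w | c <= L n w] `<=` \bigcup_n F n.
  apply: subset_bigcup => n _ w /= cL; rewrite /F/=.
  (* Before freezing, the stopped product still equals [L]; afterwards it remains at least [c],
     whatever [L] does. *)
  suff : c <= N (X n w) \/ N (X n w) = L n w by case=> [//|->].
  elim: n {cL} => [|n [cN|NL]]; first by right; rewrite /L big_ord0.
  - by left; rewrite N_past cN mulr1.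
  - rewrite N_past; case: ifP => cN; first by left; rewrite mulr1.
    by right; rewrite NL /L big_ord_recr.
apply: (@le_trans _ _ (Q (\bigcup_n F n))).
  by apply: le_measure; rewrite ?inE//; apply: bigcup_measurable => n _;
    exact: measurable_product_ge.
have FQ := nondecreasing_cvg_mu (mu := Q) mF mUF ndF.
rewrite -(cvg_lim _ FQ)//; apply: lime_le; first by apply/cvg_ex; exists (Q (\bigcup_n F n)).
by apply: nearW => n; exact: probability_stopped_product_le.
Qed.

End ville.

(** * The running p-value in terms of likelihoods *)

(** The conventions decide the edge cases: [a = 0] gives inverse [+oo], even over [b = 0], while
    [b = 0 < a] gives inverse 0. *)
Lemma inve_ratio_le (R : realType) (a b x : R) :
  0 <= a -> 0 <= b -> 0 <= x ->
  ((a%:E / b%:E)^-1 <= x%:E)%E = (0 < a) && (b <= x * a).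
Proof.
move=> a0 b0 x0; have [agt0|ale0] /= := ltP 0 a; last first.
  have -> : a = 0 by apply/eqP; rewrite eq_le ale0.
  by rewrite mul0e inve0 leye_eq.
have [->|bneq0] := eqVneq b 0.
  by rewrite inve0 gt0_muley ?lte_fin// invey lee_fin x0 mulr_ge0.
rewrite inver (negbTE bneq0) -EFinM inver mulf_eq0 invr_eq0 (negbTE bneq0).
by rewrite gt_eqF//= lee_fin invfM invrK mulrC ler_pdivrMr.
Qed.

(** The default [+oo] exceeds the real bound [x], so only an actual index can bring the minimum down
    to it. *)
Lemma bigmin_pinfty_leP (R : realType) (I : eqType) (r : seq I)
    (F : I -> \bar R) (x : R) :
  (\big[Order.min/+oo%E]_(i <- r) F i <= x%:E)%E <->
  exists2 i, i \in r & (F i <= x%:E)%E.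
Proof.
elim: r => [|j r IHr].
  by rewrite big_nil leye_eq; split => // -[].
rewrite big_cons ge_min; split.
- move=> /orP[Fj|/IHr[i ir Fi]]; first by exists j => //; rewrite mem_head.
  by exists i => //; rewrite in_cons ir orbT.
- move=> [i]; rewrite in_cons => /predU1P[-> ->//|ir Fi].
  by apply/orP; right; apply/IHr; exists i.
Qed.

(** Clears every quotient, so that measurability and the comparison of likelihoods can be handled in
    the reals. *)
Lemma running_pvalue_leP (R : realType) (Theta Omega S : Type)
    (p : Theta -> S -> R) (Y : nat -> Omega -> S)
    (theta1 : forall i : nat, i.-tuple S -> Theta)
    (theta0 : nat -> Omega -> Theta) (t : nat) (w : Omega) (x : R) :
  (forall theta y, 0 <= p theta y) -> 0 <= x ->
  (running_pvalue p Y theta1 theta0 t w <= x%:E)%E <->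
  exists2 s, (1 <= s <= t)%N &
    0 < plugin_likelihood p Y theta1 s w /\
    likelihood p Y s (theta0 s w) w <= x * plugin_likelihood p Y theta1 s w.
Proof.
move=> p0 x0.
have ratioE s : ((running_mle_ratio p Y theta1 theta0 s w)^-1 <= x%:E)%E =
    (0 < plugin_likelihood p Y theta1 s w) &&
    (likelihood p Y s (theta0 s w) w <= x * plugin_likelihood p Y theta1 s w).
  by rewrite inve_ratio_le//; apply: prodr_ge0.
rewrite /running_pvalue bigmin_pinfty_leP.
split => -[s s1t sx]; exists s.
- by move: s1t; rewrite mem_index_iota ltnS.
- by move: sx; rewrite ratioE => /andP.
- by rewrite mem_index_iota ltnS.
- by rewrite ratioE; apply/andP.
Qed.

Theorem theorem10 (R : realType) (dS dO : measure_display)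
  (S : measurableType dS) (Omega : measurableType dO)
  (Theta : Type) (Theta0 : set Theta)
  (mu : {measure set S -> \bar R})
  (P : Theta -> probability S R) (p : Theta -> S -> R)
  (hp : forall theta, is_density mu (P theta) (p theta))
  (Y : nat -> {mfun Omega >-> S})
  (Pr : Theta -> probability Omega R)
  (hY : forall theta, iid_from (Pr theta) (P theta) Y)
  (theta1 : forall i : nat, i.-tuple S -> Theta)
  (mtheta1 : forall i : nat,
     measurable_fun [set: i.-tuple S * S] (fun z => p (theta1 i z.1) z.2))
  (theta0 : nat -> Omega -> Theta)
  (htheta0 : forall (t : nat) (w : Omega), (1 <= t)%N ->
     is_argmax Theta0 (fun theta => likelihood p Y t theta w) (theta0 t w))
  (mtheta0 : forall t : nat, (1 <= t)%N ->
     measurable_fun [set: Omega] (fun w => likelihood p Y t (theta0 t w) w))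
  (T : {mfun Omega >-> nat}) (hT : forall w, (1 <= T w)%N)
  (x : R) (hx : 0 <= x <= 1) :
  (ereal_sup [set Pr theta [set w | running_pvalue p Y theta1 theta0 (T w) w <= x%:E]
             | theta in Theta0] <= x%:E)%E.
Proof.
have p0 theta y : 0 <= p theta y by have [] := hp theta.
have /andP[x0 _] := hx.
apply: ge_ereal_sup => _ [theta Theta0theta <-].
pose lik0 s w := likelihood p Y s (theta0 s w) w.
pose plug s w := plugin_likelihood p Y theta1 s w.
pose lik s w := likelihood p Y s theta w.
have mp : measurable_fun setT (p theta) by have [] := hp theta.
have mplug s : measurable_fun setT (plug s).
  apply: measurable_prod => i _.
  have mXY : measurable_fun setT (fun w => (past Y i w, Y i w)).
    by apply: measurable_fun_pair;
      [exact: measurable_past|exact: measurable_funPT].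
  exact: (measurableT_comp (@mtheta1 i) mXY).
pose E s := [set w | 0 < plug s w] `&` [set w | lik0 s w <= x * plug s w].
(* The random time enters only through [s <= T w]. This constraint serves measurability and is
   dropped when the event is bounded. *)
have EE : [set w | (running_pvalue p Y theta1 theta0 (T w) w <= x%:E)%E] =
    \bigcup_(s in [set s | (1 <= s)%N]) ([set w | (s <= T w)%N] `&` E s).
  apply/seteqP; split => w /=.
  - by move=> /(running_pvalue_leP _ _ _ _ _ p0 x0)[s /andP[s1 sT] Es]; exists s.
  - move=> [s /= s1 [sT Es]]; apply/(running_pvalue_leP _ _ _ _ _ p0 x0).
    by exists s => //; rewrite s1.
have mE s : (1 <= s)%N -> measurable (E s).
  move=> s1; apply: measurableI; rewrite -[X in measurable X]setTI.
  - by apply: (measurable_fun_ltr (f := cst 0)).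
  - by apply: measurable_fun_ler => //; [exact: mtheta0|exact: measurable_funM].
have mET : measurable
    [set w | (running_pvalue p Y theta1 theta0 (T w) w <= x%:E)%E].
  rewrite EE; apply: bigcup_measurable => s s1; apply: measurableI; last exact: mE.
  change (measurable (T @^-1` [set n | (s <= n)%N])).
  by rewrite -[X in measurable X]setTI; exact: (measurable_funPT T).
(* Outcomes at which an observation has zero density under the true [theta]; off their union every
   likelihood of [theta] is positive. *)
pose Z i := Y i @^-1` (p theta @^-1` [set 0]).
have mpz : measurable (p theta @^-1` [set 0]).
  by rewrite -[X in measurable X]setTI; exact: mp.
have mZ i : measurable (Z i).
  by rewrite -[X in measurable X]setTI; exact: (measurable_funPT (Y i)).
have Pr_Z : (Pr theta).-negligible (\bigcup_i Z i).
  apply: negligible_bigcup => i; exists (Z i); split => //.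
  have [_ YP] := hY theta.
  transitivity (P theta (p theta @^-1` [set 0])); first exact: YP.
  exact: probability_density_eq0 (hp theta).
have Pr_Z0 : Pr theta (\bigcup_i Z i) = 0%E.
  by apply: measure_negligible => //; exact: bigcup_measurable.
have lik_gt0 s w : ~ (\bigcup_i Z i) w -> 0 < lik s w.
  move=> nZw; apply: prodr_gt0 => i _; rewrite lt_def p0 andbT.
  by apply/eqP => pi0; apply: nZw; exists i.
have lik_le s w : (1 <= s)%N -> lik s w <= lik0 s w.
  by move=> s1; have [_] := htheta0 s w s1; exact.
(* The level [x^-1] requires a positive [x]. At [x = 0] the event forces the maximal null
   likelihood, hence that of [theta], to vanish, so it lies in the null event. *)
have [x_eq0|x_neq0] := eqVneq x 0.
  apply: (@le_trans _ _ (Pr theta (\bigcup_i Z i))); last by rewrite Pr_Z0.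
  apply: le_measure; rewrite ?inE//.
  - exact: bigcup_measurable.
  - rewrite EE => w [s /= s1 [_ [_ /=]]]; rewrite x_eq0 mul0r => lik0_le0.
    apply: contrapT => /(lik_gt0 s); rewrite ltNge => /negP; apply.
    exact: le_trans (lik_le _ _ s1) lik0_le0.
have x_gt0 : 0 < x by rewrite lt_def x_neq0.
pose rho n (z : n.-tuple S * S) : R := p (theta1 n z.1) z.2 / p theta z.2.
pose H := \bigcup_n [set w | x^-1 <= \prod_(i < n) rho i (past Y i w, Y i w)].
have mrho n : measurable_fun setT (@rho n).
  have mp2 : measurable_fun setT (fun z : n.-tuple S * S => p theta z.2).
    exact: (measurableT_comp mp measurable_snd).
  by apply: measurable_funM; [exact: mtheta1|exact: measurable_fun_inv].
have mH : measurable H.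
  by apply: bigcup_measurable => n _; exact: measurable_product_ge.
(* Ville's inequality at level [c = x^-1], whose bound [c^-1] is [x] again. *)
have QH : (Pr theta H <= x%:E)%E.
  apply: (@le_trans _ _ ((x^-1)^-1)%:E); last by rewrite invrK.
  apply: (ville (hY theta)) => //.
  - by move=> n z; rewrite divr_ge0.
  - move=> n z.
    exact: integral_likelihood_ratio_le1 (hp theta) (hp (theta1 n z)).
  - by rewrite invr_gt0.
apply: (@le_trans _ _ (Pr theta (H `|` \bigcup_i Z i))).
- apply: le_measure; rewrite ?inE//.
    by apply: measurableU => //; exact: bigcup_measurable.
  rewrite EE => w [s /= s1 [_ [plug_gt0 lik0_le]]].
  (* Off the null event, the chain [lik <= lik0 <= x * plug] divided by the positive [lik] and [x]
     puts the product of the [rho] above [x^-1] at time [s]. *)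
  have [Zw|/(lik_gt0 s) lik_gt0w] := pselect ((\bigcup_i Z i) w); first by right.
  left; exists s => //=; rewrite prodf_div ler_pdivlMr//.
  rewrite mulrC ler_pdivrMr// mulrC.
  exact: le_trans (lik_le _ _ s1) lik0_le.
- apply: le_trans QH; rewrite -[X in (_ <= X)%E]adde0 -[X in (_ + X)%E]Pr_Z0.
  by apply: measureU2 => //; exact: bigcup_measurable.
Qed.
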